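(* The rational points of the projective closure in $\mathbb{P}^2$ of the curve $$C_{16}:\ a^4b^2-2a^3b-2a^2b^2+a^2b+2ab^2-b^3+a^2+2b^2-2b=0$$ (with homogeneous coordinates $(a:b:c)$, the affine part being $c=1$) are exactly $$(1:1:1),\ (0:1:0),\ (0:0:1),\ (1:0:0),\ (-2:-2:1),\ (-1:1:1),\ (-1:-1:1),$$ and none of them gives a non-degenerate configuration: there is no family $(L_k)_{k\in\mathbb{Z}/16}$ of lines in $\mathbb{P}^2(\mathbb{Q})$ that is a non-degenerate configuration $\mathbb{B}_{16}$ in which no three of the four points $P_{\{0,7,9\}}$, $P_{\{1,5,10\}}$, $P_{\{6,11,15\}}$, $P_{\{0,1,15\}}$ are collinear.
   Context: A (non-degenerate) configuration $\mathbb{B}_n$ over a field $K$ is a configuration of $n$ lines with the incidences of the original Böröczky configuration of $n$ lines, with all lines and all triple points distinct: i.e. a family $(L_k)_{k\in\mathbb{Z}/n}$ of pairwise distinct lines in $\mathbb{P}^2(K)$ such that for every set $\{i,j,k\}$ of three distinct elements of $\mathbb{Z}/n$ with $i+j+k=0$ the lines $L_i,L_j,L_k$ have a common point $P_{\{i,j,k\}}$, and the points $P_{\{i,j,k\}}$, for different such sets, are pairwise distinct. (The original Böröczky configuration consists of the lines $L_k=Q_\alpha Q_{\pi-2\alpha}$, $\alpha=2k\pi/n$, where $Q_\alpha$ is the point obtained by rotating a fixed point of a circle by $\alpha$ about the center.) The curve $C_{16}$ parametrizes such configurations: if $P_{\{0,7,9\}},P_{\{1,5,10\}},P_{\{6,11,15\}},P_{\{0,1,15\}}$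 are moved to $(1:0:0),(0:1:0),(0:0:1),(1:1:1)$, then $a,b$ are defined by $P_{\{0,6,10\}}=(a:1:1)$ and $P_{\{0,5,11\}}=(b:1:1)$. *)

(* Defs.v *)
From HB Require Import structures.
From mathcomp Require Import all_boot all_order all_algebra.
From mathcomp Require Export mpoly.

Set Implicit Arguments.
Unset Strict Implicit.
Unset Printing Implicit Defensive.

Import GRing.Theory.
Local Open Scope ring_scope.

(* P^2(K) is the set of 1-dimensional subspaces of K^3, its lines are the
   2-dimensional subspaces, and incidence is inclusion; hence Leibniz equality
   on these types is equality of points and of lines. *)
Definition point (K : fieldType) := {U : {vspace 'rV[K]_3} | \dim U == 1%N}.
Definition line (K : fieldType) := {U : {vspace 'rV[K]_3} | \dim U == 2%N}.

Definition incident (K : fieldType) (p : point K) (l : line K) : Prop :=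
  (val p <= val l)%VS.

Definition collinear (K : fieldType) (p q r : point K) : Prop :=
  exists l : line K, [/\ incident p l, incident q l & incident r l].

Definition xyz (K : fieldType) (a b c : K) : 'rV[K]_3 :=
  \row_i [:: a; b; c]`_i.

(* [<[xyz a b c]>] is the point (a:b:c) as soon as (a,b,c) <> 0. *)
Definition has_coords (K : fieldType) (p : point K) (u : K * K * K) : Prop :=
  val p = <[xyz u.1.1 u.1.2 u.2]>%VS.

(* Homogenization of f in degree deg f = (msize f).-1; the homogenizing
   variable is the last one. *)
Definition homogenize (R : nzRingType) n (f : {mpoly R[n]}) : {mpoly R[n.+1]} :=
  \sum_(m <- msupp f) f@_m *:
    'X_[ [multinom (if unlift ord_max i is Some j then m j
                    else ((msize f).-1 - mdeg m)%N) | i < n.+1] ].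

(* The projective closure of the affine plane curve f = 0 (in the chart c = 1)
   is the zero locus of the homogenization of f; this is its set of K-points. *)
Definition on_projective_closure (K : fieldType) (f : {mpoly K[2]})
    (p : point K) : Prop :=
  forall v : 'rV[K]_3, v \in val p -> (homogenize f).@[v 0] = 0.

Definition C16 : {mpoly rat[2]} :=
  let a : {mpoly rat[2]} := 'X_0 in
  let b : {mpoly rat[2]} := 'X_1 in
  a ^+ 4 * b ^+ 2 - 2 * a ^+ 3 * b - 2 * a ^+ 2 * b ^+ 2 + a ^+ 2 * b
  + 2 * a * b ^+ 2 - b ^+ 3 + a ^+ 2 + 2 * b ^+ 2 - 2 * b.

(* 'Z_n is Z/n only for n > 1. *)
Definition zero_sum_triples n : {set {set 'Z_n}} :=
  [set T : {set 'Z_n} | (#|T| == 3%N) && (\sum_(i in T) i == 0)].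

(* The values of P outside [zero_sum_triples n] are irrelevant. *)
Record nondegenerate_boroczky (K : fieldType) n
    (L : 'Z_n -> line K) (P : {set 'Z_n} -> point K) : Prop := {
  boroczky_lines_distinct : injective L;
  boroczky_incidence : forall T i,
    T \in zero_sum_triples n -> i \in T -> incident (P T) (L i);
  boroczky_points_distinct : {in zero_sum_triples n &, injective P}
}.

(* Main.v *)
Require Import Defs.
From mathcomp Require Import all_boot all_order all_algebra.
From mathcomp Require Import zify ring lra.

Set Implicit Arguments.
Unset Strict Implicit.
Unset Printing Implicit Defensive.

(* With s = b - 1 and t = (ab - 1)/s, the curve C16 is the double cover
   s^2 = (t^4 - 2t^2 + 2t - 3) s + (2t^3 - 3t^2 + 2t - 2) of the t-line, with
   discriminant (t-1)^2 (t^2-1)(t^2+1)(t^2+2t-1).  In terms of x = (t-1)/(t+1)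
   its rational points give rational points of the model
   y^2 = x (x^2+1)(1+2x-x^2) of the modular curve X_1(16).  Writing x = p/q in
   lowest terms, |p| = r^2, |q| = s^2 and r^4 + s^4 is a square or twice a
   square, so Fermat's descents leave only x = 0, 1, -1.
   For the configurations, the equations of all lines involved are determined
   by a and b; the incidence of L_2, L_4, L_10 becomes a * C16(a, b) = 0, while
   distinctness of the lines gives b <> 0, a <> 1, b <> 1 and a <> b, which
   excludes every rational point. *)

(** * Fermat's descents *)

Local Open Scope nat_scope.

(** The root is gcd(a, c), because gcd(a, c)^2 = gcd(a^2, c^2) = gcd(a^2, ab) = a gcd(a, b) = a. The
    case c = 0 is split off so that one can divide by this gcd. *)
Lemma coprime_mul_sqr (a b c : nat) :
  coprime a b -> a * b = c ^ 2 -> exists d, a = d ^ 2.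
Proof.
move=> cab e; exists (gcdn a c).
have [c0|c0] := posnP c.
  move: cab e; rewrite {}c0 gcdn0 => cab /eqP; rewrite muln_eq0 => /orP[/eqP->//|].
  by move=> /eqP b0; move: cab; rewrite b0 /coprime gcdn0 => /eqP->.
have g0 : 0 < gcdn a c by rewrite gcdn_gt0 c0 orbT.
have [[a' ea] [c' ec]] := (dvdnP (dvdn_gcdl a c), dvdnP (dvdn_gcdr a c)).
have cac : coprime (a' ^ 2) (c' ^ 2).
  rewrite coprimeXl ?coprimeXr //.
  by rewrite /coprime -(eqn_pmul2r g0) muln_gcdl mul1n -ea -ec.
have <- : gcdn (a ^ 2) (c ^ 2) = gcdn a c ^ 2.
  move: ea ec; set g := gcdn a c => -> ->.
  by rewrite !expnMn -muln_gcdl (eqP cac) mul1n.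
by rewrite -e -mulnn -muln_gcdr (eqP cab) muln1.
Qed.

(** The numbers (z - x)/2 and (z + x)/2 are coprime with product (y/2)^2, so they are squares v^2
    and u^2. The relation for x is written additively to avoid truncated subtraction. *)
Lemma pythagorean_triple (x y z : nat) :
  coprime x y -> odd x -> ~~ odd y -> x ^ 2 + y ^ 2 = z ^ 2 ->
  exists u v, [/\ coprime u v, u ^ 2 = x + v ^ 2, y = 2 * (u * v)
                & z = u ^ 2 + v ^ 2].
Proof.
move=> cxy ox oy e.
have oz : odd z by have := congr1 odd e; rewrite oddD !oddX ox (negPf oy).
have lexz : x <= z by rewrite -(leq_exp2r _ _ (isT : 0 < 2)) -e leq_addr.
have ev : ~~ odd (z - x) by rewrite oddB // ox oz.
pose A := (z - x)./2.
have eA : z = x + 2 * A.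
  by rewrite mul2n -{1}(subnKC lexz) -{1}(odd_double_half (z - x)) (negPf ev).
have eY : y = 2 * y./2 by rewrite mul2n -{1}(odd_double_half y) (negPf oy).
have eAB : A * (x + A) = y./2 ^ 2 by nia.
(* A common divisor of A = (z - x)/2 and x + A = (z + x)/2 divides x, while A divides y^2. *)
have cA : coprime A (x + A).
  rewrite /coprime gcdnDr -/(coprime A x) coprime_sym.
  apply: (@coprime_dvdr _ (y ^ 2)); last by rewrite coprimeXr.
  by rewrite eY expnMn -eAB mulnCA dvdn_mulr.
have [v ev2] := coprime_mul_sqr cA eAB.
have [u eu] : exists u, x + A = u ^ 2.
  by apply: (@coprime_mul_sqr _ A y./2); rewrite 1?coprime_sym // mulnC.
exists u, v; split; [|lia| |lia].
  by rewrite -(@coprime_pexpl 2) // -(@coprime_pexpr 2) // -eu -ev2 coprime_sym.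
apply/eqP; rewrite -(eqn_exp2r _ _ (isT : 0 < 2)) eY !expnMn -eAB eu ev2.
by rewrite (mulnC (v ^ 2)).
Qed.

Lemma coprime_mul_sqr_both (a b c : nat) :
  coprime a b -> a * b = c ^ 2 ->
  exists d e, [/\ a = d ^ 2, b = e ^ 2 & c = d * e].
Proof.
move=> cab e; have [d ed] := coprime_mul_sqr cab e.
have [f ef] : exists f, b = f ^ 2.
  by apply: (@coprime_mul_sqr _ a c); rewrite 1?coprime_sym // mulnC.
exists d, f; split=> //; apply/eqP.
by rewrite -(eqn_exp2r _ _ (isT : 0 < 2)) -e ed ef expnMn.
Qed.

Lemma sqr_mod4 (n : nat) : n ^ 2 %% 4 = odd n.
Proof.
rewrite -{1}(odd_double_half n) -mul2n; case: (odd n) => /=; set h := n./2.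
  by rewrite (_ : (1 + 2 * h) ^ 2 = 1 + (h ^ 2 + h) * 4) ?modnMDl ?modnDmr ?modnMDr //;
    [rewrite addnC modnMDl | nia].
by rewrite (_ : (0 + 2 * h) ^ 2 = h ^ 2 * 4) ?modnMl //; nia.
Qed.

Lemma sum_odd_sqr_not_sqr (x y z : nat) : odd x -> odd y -> x ^ 2 + y ^ 2 <> z ^ 2.
Proof.
move=> ox oy e; have := congr1 (modn^~ 4) e.
by rewrite -modnDm !sqr_mod4 ox oy; case: (odd z).
Qed.

Lemma coprime_add_sqr (x v u : nat) : coprime u v -> x ^ 2 + v ^ 2 = u ^ 2 -> coprime x v.
Proof.
move=> cuv e; rewrite -(@coprime_pexpl 2) // -(@coprime_pexpr 2) //.
by rewrite coprime_sym /coprime -gcdnDr e -/(coprime _ _) coprime_sym coprimeXl ?coprimeXr.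
Qed.

Lemma leq_sqr (n : nat) : n <= n ^ 2.
Proof. by case: n => // n; rewrite leq_pmulr. Qed.

(** Descent on z. With y even, a first triple gives x^2 = u^2 - v^2, y^2 = 2uv, z = u^2 + v^2. A
    second one, for x^2 + v^2 = u^2, gives v = 2pq and u = p^2 + q^2. Then u p q = (y/2)^2 with
    coprime factors, so u = c^2, p = r^2, q = s^2 and r^4 + s^4 = c^2 with c < z. *)
Lemma fermat_sum_fourth_powers (x y z : nat) :
  coprime x y -> 0 < x -> 0 < y -> x ^ 4 + y ^ 4 <> z ^ 2.
Proof.
have [n] := ubnP z; elim: n z x y => // n IH z x y.
wlog ox : x y / odd x => [H|].
  case ox: (odd x); first exact: H.
  case oy: (odd y) => lzn cxy x0 y0.
    by rewrite addnC; apply: H; rewrite // coprime_sym.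
  have : 2 %| gcdn x y by rewrite dvdn_gcd !dvdn2 ox oy.
  by rewrite (eqP cxy).
move=> lzn cxy x0 y0 e.
have e2 : (x ^ 2) ^ 2 + (y ^ 2) ^ 2 = z ^ 2 by rewrite -!expnM.
have oy : ~~ odd y.
  by apply/negP => oy; apply: sum_odd_sqr_not_sqr e2; rewrite oddX.
have [|||u [v [cuv eu ey ez]]] := pythagorean_triple _ _ _ e2.
- by rewrite coprimeXl ?coprimeXr.
- by rewrite oddX ox.
- by rewrite oddX negb_or oy.
have v0 : 0 < v by case: (v) ey y0 => //; rewrite !muln0; case: (y).
have ov : ~~ odd v.
  by apply/negP => ov; apply: (@sum_odd_sqr_not_sqr x v u).
have [|p [q [cpq ep ev eu2]]] := pythagorean_triple _ ox ov (esym eu).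
  exact: coprime_add_sqr cuv (esym eu).
have eY : y = 2 * y./2 by rewrite mul2n -{1}(odd_double_half y) (negPf oy).
have e3 : u * (p * q) = y./2 ^ 2 by nia.
have [|c [d [ec ed _]]] := coprime_mul_sqr_both _ e3.
  by apply: coprime_dvdr cuv; rewrite ev dvdn_mull.
have [r [s [er es _]]] := coprime_mul_sqr_both cpq ed.
apply: (IH c r s).
- apply: (@leq_trans z); last by rewrite -ltnS.
  rewrite ez ec -addn1 leq_add ?expn_gt0 ?v0 //.
  by apply: leq_trans (leq_sqr _) (leq_sqr _).
- by move: cpq; rewrite er es coprime_pexpl // coprime_pexpr.
- by rewrite lt0n; apply/negP => /eqP r0; move: v0; rewrite ev er r0; lia.
- by rewrite lt0n; apply/negP => /eqP r0; move: v0; rewrite ev es r0; lia.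
- by rewrite -ec eu2 er es -!expnM.
Qed.

(** Descent on x, starting from the triple z^2 + (y^2)^2 = (x^2)^2 and splitting on the parity of
    y. *)
Lemma fermat_diff_fourth_powers (x y z : nat) :
  coprime x y -> 0 < y -> 0 < z -> x ^ 4 <> y ^ 4 + z ^ 2.
Proof.
have [n] := ubnP x; elim: n x y z => // n IH x y z lxn cxy y0 z0 e.
suff [x' [y' [z' [lx cxy' y0' z0' e']]]] : exists x' y' z',
    [/\ x' < x, coprime x' y', 0 < y', 0 < z' & x' ^ 4 = y' ^ 4 + z' ^ 2].
  by apply: (IH x' y' z') => //; apply: leq_trans lx _; rewrite -ltnS.
have e2 : z ^ 2 + (y ^ 2) ^ 2 = (x ^ 2) ^ 2 by rewrite -!expnM addnC.
have czy : coprime z (y ^ 2).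
  by apply: (coprime_add_sqr _ e2); rewrite coprimeXl ?coprimeXr.
case oy: (odd y).
  have oz : ~~ odd z.
    by apply/negP => oz; apply: sum_odd_sqr_not_sqr e2; rewrite ?oddX ?oy.
  have [||||u [v [cuv eu ez ex]]] := @pythagorean_triple (y ^ 2) z (x ^ 2).
  - by rewrite coprime_sym.
  - by rewrite oddX oy.
  - by [].
  - by rewrite addnC.
  have v0 : 0 < v by case: (v) ez z0 => //; rewrite !muln0 => ->.
  (* Here y^2 = u^2 - v^2 and x^2 = u^2 + v^2, whose product is u^4 - v^4 = (xy)^2. *)
  exists u, v, (x * y); split=> //.
  - by rewrite -(ltn_exp2r _ _ (isT : 0 < 2)) ex -addn1 leq_add2l expn_gt0 v0.
  - by rewrite muln_gt0 y0 andbT -(ltn_exp2r _ _ (isT : 0 < 4)) e addn_gt0 expn_gt0 y0.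
  - by rewrite (expnM u 2 2) (expnM v 2 2) expnMn ex eu; ring.
have oz : odd z.
  have /(congr1 odd) := e2; rewrite oddD !oddX oy /= addbF => ->.
  apply/negPn/negP => ox.
  have : 2 %| gcdn x y by rewrite dvdn_gcd !dvdn2 ox oy.
  by rewrite (eqP cxy).
have [|u [v [cuv eu ey ex]]] := pythagorean_triple czy oz _ e2.
  by rewrite oddX oy.
have {}ey : 2 * (u * v) = y ^ 2 by rewrite ey.
have ouv : odd u != odd v.
  have /(congr1 odd) := eu; rewrite oddD !oddX oz /=.
  by case: (odd u); case: (odd v).
(* The relations y^2 = 2uv and x^2 = u^2 + v^2 are symmetric, so the odd one of u, v may be called
   u'. Then u' = c^2 and v'/2 = d^2. The triple u'^2 + v'^2 = x^2 has parameters p = f^2 and q =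
   g^2, since pq = d^2, and p^2 = u' + q^2 becomes f^4 = g^4 + c^2. *)
have {eu ouv} [u' [v' [ou ov {}cuv {}ey {}ex]]] : exists u' v',
   [/\ odd u', ~~ odd v', coprime u' v', 2 * (u' * v') = y ^ 2
    & x ^ 2 = u' ^ 2 + v' ^ 2].
  case ou: (odd u) ouv; case ov: (odd v) => // _; [exists u, v|exists v, u].
    by rewrite ou ov.
  by rewrite ou ov coprime_sym (mulnC v) (addnC (v ^ 2)).
have eY : y = 2 * y./2 by rewrite mul2n -{1}(odd_double_half y) oy.
have eV : v' = 2 * v'./2 by rewrite mul2n -{1}(odd_double_half v') (negPf ov).
have e3 : u' * v'./2 = y./2 ^ 2 by nia.
have [|c [d [ec ed ycd]]] := coprime_mul_sqr_both _ e3.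
  by apply: coprime_dvdr cuv; rewrite {2}eV dvdn_mull.
have y20 : 0 < y./2 by lia.
have c0 : 0 < c by case: (c) ycd y20 => // ->; rewrite mul0n.
have d0 : 0 < d by case: (d) ycd y20 => // ->; rewrite muln0.
have [p [q [cpq ep epq exx]]] := pythagorean_triple cuv ou ov (esym ex).
have epq2 : p * q = d ^ 2 by rewrite -ed; lia.
have [f [g [ef eg dfg]]] := coprime_mul_sqr_both cpq epq2.
have f0 : 0 < f by case: (f) dfg d0 => // ->; rewrite mul0n.
have g0 : 0 < g by case: (g) dfg d0 => // ->; rewrite muln0.
exists f, g, c; split=> //.
- rewrite exx ef eg -addn1 leq_add ?expn_gt0 ?g0 //.
  by apply: leq_trans (leq_sqr _) (leq_sqr _).
- by move: cpq; rewrite ef eg coprime_pexpl // coprime_pexpr.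
- by rewrite (expnM f 2 2) (expnM g 2 2) -ef -eg ep -ec addnC.
Qed.

(** With z = (r^4 - s^4)/2 one has w^2 = s^4 + z, hence w^4 - (rs)^4 = z^2; the previous descent
    forces z = 0 or rs = 0. *)
Lemma sum_fourth_powers_eq_double_sqr (r s w : nat) :
  coprime r s -> r ^ 4 + s ^ 4 = 2 * w ^ 2 -> r = s.
Proof.
wlog lsr : r s / s <= r => [H crs e|crs e].
  have [lsr|lrs] := leqP s r; first exact: H.
  by apply/esym/H; rewrite 1?ltnW // 1?coprime_sym // addnC.
have cwr : coprime w r.
  rewrite coprime_sym; apply: (@coprime_dvdr _ (2 * w ^ 2)).
    by rewrite -mulnn mulnA dvdn_mull.
  by rewrite -e expnSr /coprime gcdnMDl -/(coprime _ _) coprimeXr.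
have cws : coprime w s.
  rewrite coprime_sym; apply: (@coprime_dvdr _ (2 * w ^ 2)).
    by rewrite -mulnn mulnA dvdn_mull.
  by rewrite -e addnC expnSr /coprime gcdnMDl -/(coprime _ _) coprimeXr // coprime_sym.
have lsr4 : s ^ 4 <= r ^ 4 by rewrite leq_exp2r.
have [z ez] : exists z, r ^ 4 = s ^ 4 + 2 * z.
  exists (w ^ 2 - s ^ 4); lia.
have [z0|z0] := posnP z.
  by apply/eqP; rewrite -(eqn_exp2r _ _ (isT : 0 < 4)) ez z0 addn0.
have [s0|s0] := posnP s.
  move: crs e; rewrite s0 /coprime gcdn0 => /eqP->; lia.
have r0 : 0 < r by apply: leq_trans lsr.
case: (@fermat_diff_fourth_powers w (r * s) z) => //.
- by rewrite coprimeMr cwr.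
- by rewrite muln_gt0 r0.
have ew : w ^ 2 = s ^ 4 + z by lia.
by rewrite (expnM w 2 2) ew expnMn ez; ring.
Qed.

(** * Rational points of C16 *)

Import Order.TTheory GRing.Theory Num.Theory.
Local Open Scope ring_scope.

(** * Rational points of the model of X_1(16) *)

(** A common divisor of S and M divides k(S + M) = 2q(p + q), but S is coprime to 2, to q, and to p
    + q because (p + q)^2 = kS + 2pq. *)
Lemma odd_sqrD_coprime (p q S M : int) (k : nat) :
  coprimez p q -> odd `|S| ->
  k%:Z * S = p ^+ 2 + q ^+ 2 -> k%:Z * M = q ^+ 2 + 2 * p * q - p ^+ 2 ->
  coprimez S M.
Proof.
move=> cpq oS eS eM.
have cS2 : coprimez S 2 by rewrite coprimezE coprimen2.
have cSp : coprimez S p.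
  have : coprimez p (k%:Z * S).
    by rewrite eS expr2 /coprimez gcdzMDl -/(coprimez _ _) coprimezXr.
  by rewrite coprimezMr => /andP[_]; rewrite coprimez_sym.
have cSq : coprimez S q.
  have : coprimez q (k%:Z * S).
    by rewrite eS addrC expr2 /coprimez gcdzMDl -/(coprimez _ _) coprimezXr // coprimez_sym.
  by rewrite coprimezMr => /andP[_]; rewrite coprimez_sym.
have cSpq : coprimez S (p + q).
  rewrite -(@coprimez_pexpr 2) //.
  rewrite (_ : (p + q) ^+ 2 = k%:Z * S + 2 * p * q); last by rewrite eS; ring.
  by rewrite /coprimez gcdzMDl -/(coprimez _ _) !coprimezMr cS2 cSp cSq.
have : coprimez S (k%:Z * (1 * S + M)).
  have -> : k%:Z * (1 * S + M) = 2 * (q * (p + q)) by rewrite mul1r mulrDr eS eM; ring.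
  by rewrite !coprimezMr cS2 cSq.
by rewrite coprimezMr => /andP[_]; rewrite {1}/coprimez gcdzMDl.
Qed.

(** The only possible common prime factor of the two quadratic forms is 2. Taking k = 2 when p and q
    are both odd and k = 1 otherwise makes the cofactor S odd. *)
Lemma sum_sqr_coprime_cofactor (p q : int) :
  coprimez p q -> exists k S M : nat,
  [/\ (k == 1) || (k == 2), coprime S M,
       (k * S = `|p| ^ 2 + `|q| ^ 2)%N & (k * M = `|(q ^+ 2 + 2 * p * q - p ^+ 2)%R|)%N].
Proof.
move=> cpq; set m := (q ^+ 2 + _ - _)%R.
suff [k [S [M [kb oS eS eM]]]] : exists k : nat, exists S M : int,
    [/\ (k == 1%N) || (k == 2%N), odd `|S|, k%:Z * S = p ^+ 2 + q ^+ 2 & k%:Z * M = m].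
  exists k, `|S|%N, `|M|%N; split=> //.
  - by have := odd_sqrD_coprime cpq oS eS eM; rewrite coprimezE.
  - have := congr1 absz eS; rewrite abszM /= => ->.
    by rewrite -!abszX; lia.
  - by have := congr1 absz eM; rewrite abszM /= => ->.
have half (n : int) : exists i : int, n = (odd `|n|)%:Z + 2 * i.
  by exists ((n - (odd `|n|)%:Z) %/ 2)%Z; lia.
have [[i ei] [j ej]] := (half p, half q).
case op: (odd `|p|) ei => ei; case oq: (odd `|q|) ej => ej.
- have {}ei : p = 1 + 2 * i by []; have {}ej : q = 1 + 2 * j by [].
  (* These are the halves of the two forms, expanded at p = 1 + 2i and q = 1 + 2j. *)
  exists 2%N, (2 * i ^+ 2 + 2 * i + 2 * j ^+ 2 + 2 * j + 1),
    (2 * j ^+ 2 + 2 * j - 2 * i ^+ 2 - 2 * i + 4 * i * j + 2 * i + 2 * j + 1).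
  split=> //; [lia|rewrite ei ej; ring|rewrite /m ei ej; ring].
- exists 1%N, (p ^+ 2 + q ^+ 2), m; split=> //; rewrite ?mul1r //.
  have : odd `|p ^+ 2| by rewrite abszX oddX op.
  have : ~~ odd `|q ^+ 2| by rewrite abszX oddX oq.
  by lia.
- exists 1%N, (p ^+ 2 + q ^+ 2), m; split=> //; rewrite ?mul1r //.
  have : ~~ odd `|p ^+ 2| by rewrite abszX oddX op.
  have : odd `|q ^+ 2| by rewrite abszX oddX oq.
  by lia.
- have : (2 %| gcdn `|p| `|q|)%N by rewrite dvdn_gcd !dvdn2 op oq.
  by move: cpq; rewrite coprimezE => /eqP->.
Qed.

(** Up to sign, p, q and the product of the two quadratic forms are pairwise coprime with square
    product, so each is a square. The last one is k^2 S M up to sign, so S M and then S are squares,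
    and p^2 + q^2 = k S reads r^4 + s^4 = k c^2: impossible for k = 1, and forcing r = s = 1 for k =
    2. *)
Lemma x1_16_int_points (p q : int) (w : nat) :
  p != 0 -> q != 0 -> coprimez p q ->
  (`|(p * q * (p ^+ 2 + q ^+ 2) * (q ^+ 2 + 2 * p * q - p ^+ 2))%R| = w ^ 2)%N ->
  `|p|%N = 1%N /\ `|q|%N = 1%N.
Proof.
move=> p0 q0 cpq.
have cpM : coprimez p (q ^+ 2 + 2 * p * q - p ^+ 2).
  rewrite (_ : _ - _ = (2 * q - p) * p + q ^+ 2); last by ring.
  by rewrite /coprimez gcdzMDl -/(coprimez _ _) coprimezXr.
have cqM : coprimez q (q ^+ 2 + 2 * p * q - p ^+ 2).
  rewrite (_ : _ - _ = (q + 2 * p) * q + - p ^+ 2); last by ring.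
  by rewrite /coprimez gcdzMDl -/(coprimez _ _) coprimezN coprimezXr // coprimez_sym.
have cpS : coprimez p (p ^+ 2 + q ^+ 2).
  by rewrite expr2 /coprimez gcdzMDl -/(coprimez _ _) coprimezXr.
have cqS : coprimez q (p ^+ 2 + q ^+ 2).
  by rewrite addrC expr2 /coprimez gcdzMDl -/(coprimez _ _) coprimezXr // coprimez_sym.
have [k [S [M [kb cSM eS eM]]]] := sum_sqr_coprime_cofactor cpq.
have eS' : (k * S = `|(p ^+ 2 + q ^+ 2)%R|)%N by rewrite eS -!abszX; lia.
move: cpq cpM cqM cpS cqS p0 q0; rewrite -!absz_gt0 !coprimezE !abszM -eM -eS'.
move: eS; move: `|p|%N `|q|%N => P Q eS cPQ cPM cQM cPS cQS P0 Q0 e.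
have e1 : (P * (Q * (k * S * (k * M))) = w ^ 2)%N by rewrite -e; ring.
have [|r [v [eP ev _]]] := coprime_mul_sqr_both _ e1.
  by rewrite coprimeMr cPQ coprimeMr cPS cPM.
have [|s [t [eQ et _]]] := coprime_mul_sqr_both _ ev.
  by rewrite coprimeMr cQS cQM.
have k0 : (0 < k)%N by case/orP: kb => /eqP->.
have /dvdnP[t' et'] : (k %| t)%N.
  by rewrite -(@dvdn_pexp2r _ _ 2) // -et; apply/dvdnP; exists (S * M)%N; ring.
have e3 : (S * M = t' ^ 2)%N.
  apply/eqP; rewrite -(eqn_pmul2l (_ : 0 < k ^ 2)%N) ?expn_gt0 ?k0 //; apply/eqP.
  by transitivity (k * S * (k * M))%N; [ring|rewrite et et'; ring].
have [c eSc] := coprime_mul_sqr cSM e3.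
have crs : coprime r s by move: cPQ; rewrite eP eQ coprime_pexpl // coprime_pexpr.
have r0 : (0 < r)%N by move: P0; rewrite eP expn_gt0 orbF.
have s0 : (0 < s)%N by move: Q0; rewrite eQ expn_gt0 orbF.
have e4 : (r ^ 4 + s ^ 4 = k * c ^ 2)%N by rewrite -eSc eS eP eQ -!expnM.
case/orP: kb => /eqP ek; rewrite ek in e4.
  by case: (@fermat_sum_fourth_powers r s c) => //; rewrite e4 mul1n.
have ers := sum_fourth_powers_eq_double_sqr crs e4.
move: crs; rewrite ers /coprime gcdnn => /eqP s1.
by rewrite eP eQ ers s1.
Qed.

Lemma x1_16_points (x y : rat) :
  y ^+ 2 = x * (x ^+ 2 + 1) * (1 + 2 * x - x ^+ 2) -> [|| x == 0, x == 1 | x == -1].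
Proof.
move=> e.
have [->//|x0] := eqVneq x 0.
set p := numq x; set q := denq x; set m := numq y; set d := denq y.
have q0 : q%:~R != 0 :> rat by rewrite intr_eq0 denq_neq0.
have d0 : d%:~R != 0 :> rat by rewrite intr_eq0 denq_neq0.
have ex : x = p%:~R / q%:~R by rewrite divq_num_den.
have ey : y = m%:~R / d%:~R by rewrite divq_num_den.
(* The right-hand side of the model has degree 5 in x; multiplying by q^6 instead of q^5 keeps the
   left side a square and adds the factor q. *)
have eZ : (m * q ^+ 3) ^+ 2 =
    p * q * (p ^+ 2 + q ^+ 2) * (q ^+ 2 + 2 * p * q - p ^+ 2) * d ^+ 2.
  apply/eqP; rewrite -(eqr_int rat); apply/eqP.
  move: e; rewrite ex ey !(rmorphM, rmorphXn, rmorphD, rmorphB) /= => e.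
  transitivity ((m%:~R / d%:~R) ^+ 2 * (q%:~R ^+ 3 * d%:~R) ^+ 2 : rat); first by field.
  by rewrite e; field.
have eN : (`|(m * q ^+ 3)%R| ^ 2 =
    `|(p * q * (p ^+ 2 + q ^+ 2) * (q ^+ 2 + 2 * p * q - p ^+ 2))%R| * `|d| ^ 2)%N.
  by rewrite -!abszX -abszM eZ.
have /dvdnP[w ew] : (`|d| %| `|(m * q ^+ 3)%R|)%N.
  by rewrite -(@dvdn_pexp2r _ _ 2) // eN dvdn_mull.
have d0' : (0 < `|d| ^ 2)%N by rewrite expn_gt0 absz_gt0 denq_neq0.
have [||||hp hq] := @x1_16_int_points p q w.
- by rewrite numq_eq0.
- exact: denq_neq0.
- by rewrite coprimezE coprime_num_den.
- by apply/eqP; rewrite -(eqn_pmul2r d0') -eN ew expnMn.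
have q1 : q = 1 by rewrite -[q]gtz0_abs ?denq_gt0 // hq.
rewrite ex q1 [p]intEsign hp mulr1 divr1.
by case: (p < 0); rewrite ?expr1 ?expr0 eqxx !orbT.
Qed.

(** * Affine points of C16 *)

(** The function given by the polynomial [C16], over a general ring because the configuration
    argument is carried out over any field. *)
Definition c16 (K : comNzRingType) (a b : K) : K :=
  a ^+ 4 * b ^+ 2 - 2 * a ^+ 3 * b - 2 * a ^+ 2 * b ^+ 2 + a ^+ 2 * b
  + 2 * a * b ^+ 2 - b ^+ 3 + a ^+ 2 + 2 * b ^+ 2 - 2 * b.

Lemma c16_affine_points (a b : rat) : c16 a b = 0 ->
  (a, b) \in [:: (1, 1); (0, 0); (-2, -2); (-1, 1); (-1, -1)].
Proof.
rewrite /c16 => e; rewrite !inE !xpair_eqE.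
(* The cases b = 1, where t is undefined, and b = 0, where a cannot be recovered from t and s, are
   solved directly. *)
have [b1|b1] := eqVneq b 1.
  have /eqP : (a - 1) ^+ 3 * (a + 1) = 0 by rewrite -e b1; ring.
  rewrite mulf_eq0 expf_eq0 subr_eq0 addr_eq0 b1 => /orP[/andP[_ /eqP->]|/eqP->] //.
have [b0|b0] := eqVneq b 0.
  have /eqP : a ^+ 2 = 0 by rewrite -e b0; ring.
  by rewrite expf_eq0 /= b0 => /eqP->.
have s0 : b - 1 != 0 by rewrite subr_eq0.
set s := b - 1 in s0.
pose t := (a * b - 1) / s.
have ea : a = (1 + t * s) / b by rewrite /t; field; rewrite b0 s0.
have eb : b = 1 + s by rewrite /s; ring.
(* After the substitution, b^2 times [c16 a b] is s^3 times this quadratic in s. *)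
have eq2 : 2 * t ^+ 3 - 3 * t ^+ 2 + 2 * t - 2
    + s * (t ^+ 4 - 2 * t ^+ 2 + 2 * t - 3) - s ^+ 2 = 0.
  apply: (mulfI (expf_neq0 3 s0)); rewrite mulr0 -(mulr0 (b ^+ 2)) -e ea eb.
  by field; rewrite -eb.
have et t0 : t = t0 -> a * b = 1 + t0 * s by move=> <-; rewrite ea; field.
(* At t = 1 and t = -1 the discriminant vanishes and the map to the model is undefined; there the
   quadratic in s is minus a perfect square. *)
have [t1|t1] := eqVneq t 1.
  have /eqP : (s + 1) ^+ 2 = 0 by rewrite -[RHS]oppr0 -eq2 t1; ring.
  by rewrite expf_eq0 /= addrC -eb (negPf b0).
have [tm1|tm1] := eqVneq t (-1).
  have /eqP : (s + 3) ^+ 2 = 0 by rewrite -[RHS]oppr0 -eq2 tm1; ring.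
  rewrite expf_eq0 /= => /eqP s3; have sE : s = -3 by lra.
  have bE : b = -2 by lra.
  have := et _ tm1; rewrite bE sE => aE; have -> : a = -2 by lra.
  by rewrite !eqxx !orbT.
have t10 : t - 1 != 0 by rewrite subr_eq0.
have t11 : t + 1 != 0 by rewrite addr_eq0.
(* The quantity 2s - (t^4 - 2t^2 + 2t - 3) is a square root of the discriminant in s. Of the three
   values of x, 0 means t = 1, which is excluded, 1 is never attained, and -1 means t = 0. *)
have := @x1_16_points ((t - 1) / (t + 1))
  (2 * (2 * s - (t ^+ 4 - 2 * t ^+ 2 + 2 * t - 3)) / ((t - 1) * (t + 1) ^+ 3)).
case/(_ _)/or3P.
- have -> : (2 * (2 * s - (t ^+ 4 - 2 * t ^+ 2 + 2 * t - 3)) / ((t - 1) * (t + 1) ^+ 3)) ^+ 2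
    = 4 * ((t ^+ 4 - 2 * t ^+ 2 + 2 * t - 3) ^+ 2 + 4 * (2 * t ^+ 3 - 3 * t ^+ 2 + 2 * t - 2)
       - 4 * (2 * t ^+ 3 - 3 * t ^+ 2 + 2 * t - 2
    + s * (t ^+ 4 - 2 * t ^+ 2 + 2 * t - 3) - s ^+ 2)) / ((t - 1) * (t + 1) ^+ 3) ^+ 2.
    by field; rewrite t10 t11.
  by rewrite eq2; field; rewrite t10 t11.
- by rewrite mulf_eq0 invr_eq0 (negPf t10) (negPf t11).
- by rewrite -(inj_eq (mulIf t11)) divfK // mul1r => /eqP ?; exfalso; lra.
rewrite -(inj_eq (mulIf t11)) divfK // mulN1r => /eqP e0.
have tE : t = 0 by lra.
have /eqP : (s + 1) * (s + 2) = 0 by rewrite -[RHS]oppr0 -eq2 tE; ring.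
rewrite mulf_eq0 addrC -eb (negPf b0) /= => /eqP s2.
have bE : b = -1 by lra.
have := et _ tE; rewrite bE mul0r addr0 => aE; have -> : a = -1 by lra.
by rewrite !eqxx !orbT.
Qed.

(** * The homogenization of C16 and its projective points *)

(** A duplicate-free list of monomials with nonzero coefficients is the support up to permutation,
    so the sum and the degree in [homogenize] can be computed along that list. *)
Lemma meval_homogenize_sum (R : comNzRingType) n (r : seq 'X_{1..n})
    (c : 'X_{1..n} -> R) (v : 'I_n.+1 -> R) :
  uniq r -> {in r, forall m, c m != 0} ->
  (homogenize (\sum_(m <- r) c m *: 'X_[m])).@[v] =
  \sum_(m <- r) c m * ((\prod_(i < n) v (lift ord_max i) ^+ m i)
     * v ord_max ^+ ((\max_(k <- r) (mdeg k).+1).-1 - mdeg m)).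
Proof.
move=> ur cr; set p := \sum_(m <- r) _.
have pr : perm_eq (msupp p) r by apply: msupp_sumX.
have cp m : m \in r -> p@_m = c m.
  move=> mr; rewrite raddf_sum (bigD1_seq m) //= mcoeffZ mcoeffX eqxx mulr1.
  by rewrite big1 ?addr0 // => k /negPf nk; rewrite mcoeffZ mcoeffX nk mulr0.
have sp : msize p = \max_(k <- r) (mdeg k).+1 by rewrite msizeE (perm_big _ pr).
rewrite /homogenize sp (perm_big _ pr) raddf_sum; apply: eq_big_seq => m mr /=.
rewrite mevalZ mevalX cp // big_ord_recr /= mnmE unlift_none; congr (_ * (_ * _)).
apply: eq_bigr => i _; rewrite mnmE.
have -> : widen_ord (leqnSn n) i = lift ord_max i by apply: ord_inj; rewrite lift_max.
by rewrite liftK.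
Qed.

Definition mnm2 (i j : nat) : 'X_{1..2} := [multinom (if val k == 0 then i else j) | k < 2].

Definition C16_support : seq (nat * nat) :=
  [:: (4, 2); (3, 1); (2, 2); (2, 1); (1, 2); (0, 3); (2, 0); (0, 2); (0, 1)]%N.

(** The coefficients are listed in the order of [C16_support]; monomials outside it get the default
    0. *)
Definition C16_coef (m : 'X_{1..2}) : rat :=
  nth 0 [:: 1; -2; -2; 1; 2; -1; 1; 2; -2] (index (m 0, m 1) C16_support).

Lemma mnm2K : cancel (fun ij => mnm2 ij.1 ij.2) (fun m => (m 0, m 1)).
Proof. by case=> i j; rewrite !mnmE. Qed.

Lemma mpolyX_mnm2 i j : 'X_[mnm2 i j] = 'X_0 ^+ i * 'X_1 ^+ j :> {mpoly rat[2]}.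
Proof.
by rewrite mpolyXE_id !big_ord_recl big_ord0 mulr1 !mnmE.
Qed.

Lemma C16_sum : C16 = \sum_(m <- [seq mnm2 ij.1 ij.2 | ij <- C16_support]) C16_coef m *: 'X_[m].
Proof.
rewrite big_map /C16_support !big_cons big_nil /C16_coef !mnmE /= !mpolyX_mnm2 /C16.
rewrite -!mul_mpolyC.
have c2 : (2 : rat)%:MP_[2] = 2 by rewrite mpolyC_nat.
rewrite !mpolyCN !mpolyC1 !c2; ring.
Qed.

Lemma meval_homogenize_C16 (v : 'I_3 -> rat) :
  let x := v 0 in let y := v 1 in let z := v 2 in
  (homogenize C16).@[v] =
  x ^+ 4 * y ^+ 2 - 2 * x ^+ 3 * y * z ^+ 2 - 2 * x ^+ 2 * y ^+ 2 * z ^+ 2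
  + x ^+ 2 * y * z ^+ 3 + 2 * x * y ^+ 2 * z ^+ 3 - y ^+ 3 * z ^+ 3
  + x ^+ 2 * z ^+ 4 + 2 * y ^+ 2 * z ^+ 4 - 2 * y * z ^+ 5.
Proof.
move=> x y z; rewrite C16_sum meval_homogenize_sum; first last.
- by move=> m /mapP[ij ij_supp ->]; move: ij_supp; rewrite !inE;
    do 8?[case/orP => [/eqP->|]]; last move=> /eqP->; rewrite /C16_coef !mnmE.
- by rewrite (map_inj_uniq (can_inj mnm2K)).
have deg i j : mdeg (mnm2 i j) = (i + j)%N.
  by rewrite mdegE !big_ord_recl big_ord0 !mnmE addn0.
have v0 : v (lift ord_max (0 : 'I_2)) = x by congr v; apply: val_inj.
have v1 : v (lift ord_max (1 : 'I_2)) = y by congr v; apply: val_inj.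
have v2 : v ord_max = z by congr v; apply: val_inj.
have ev i j : \prod_(k < 2) v (lift ord_max k) ^+ mnm2 i j k = x ^+ i * y ^+ j.
  rewrite !big_ord_recl big_ord0 mulr1 !mnmE /= -v0 -v1.
  by congr (v _ ^+ _ * v _ ^+ _); apply: val_inj.
rewrite !big_map /C16_support !big_cons !big_nil !ev !deg v2 /C16_coef !mnmE /=.
ring.
Qed.

Lemma vline_scale (K : fieldType) (vT : vectType K) (k : K) (v : vT) :
  k != 0 -> (<[k *: v]> = <[v]>)%VS.
Proof.
move=> k0; apply/eqP; rewrite eqEdim -memvE memvZ ?memv_line //=.
by rewrite !dim_vline scaler_eq0 negb_or k0.
Qed.

Lemma point_span (K : fieldType) (p : point K) :
  exists2 w : 'rV[K]_3, w != 0 & val p = <[w]>%VS.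
Proof.
have dp := eqP (valP p).
have w0 : vpick (val p) != 0 by rewrite vpick0 -dimv_eq0 dp.
exists (vpick (val p)) => //.
by apply/esym/eqP; rewrite eqEdim -memvE memv_pick dp dim_vline w0.
Qed.

Lemma xyzE (K : fieldType) (w : 'rV[K]_3) : w = xyz (w 0 0) (w 0 1) (w 0 2).
Proof.
apply/rowP => i; rewrite mxE.
by case: i => [[|[|[|//]]] i3] /=; congr (w _ _); apply: val_inj.
Qed.

Lemma xyz_scale (K : fieldType) (k a b c : K) :
  k *: xyz a b c = xyz (k * a) (k * b) (k * c).
Proof. by apply/rowP => i; rewrite !mxE; case: i => [[|[|[|//]]] i3]. Qed.

Lemma xyz_eq0 (K : fieldType) (a b c : K) :
  (xyz a b c == 0) = [&& a == 0, b == 0 & c == 0].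
Proof.
apply/eqP/and3P => [e|[/eqP-> /eqP-> /eqP->]].
  by split; apply/eqP;
    [have := congr1 (fun w : 'rV_3 => w 0 0) e | have := congr1 (fun w : 'rV_3 => w 0 1) e
    | have := congr1 (fun w : 'rV_3 => w 0 2) e]; rewrite !mxE.
by apply/rowP => i; rewrite !mxE; case: i => [[|[|[|//]]] i3].
Qed.

Lemma C16_projective_points (p : point rat) :
  on_projective_closure C16 p <->
  exists2 u : rat * rat * rat,
    u \in [:: (1, 1, 1); (0, 1, 0); (0, 0, 1); (1, 0, 0);
              (-2, -2, 1); (-1, 1, 1); (-1, -1, 1)]
    & has_coords p u.
Proof.
rewrite /on_projective_closure /has_coords; split.
  have [w w0 ->] := point_span p => /(_ w (memv_line w)).
  rewrite meval_homogenize_C16 /=; move: w0; rewrite (xyzE w).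
  move: (w 0 0) (w 0 1) (w 0 2) => x y z; rewrite xyz_eq0 !mxE /= => w0 e.
  (* On the line at infinity the sextic form reduces to x^4 y^2, which leaves two points; elsewhere
     dividing by z leads to the affine curve. *)
  have [z0|z0] := eqVneq z 0.
    have /eqP : x ^+ 4 * y ^+ 2 = 0 by rewrite -e z0; ring.
    rewrite mulf_eq0 !expf_eq0 /= z0 => /orP[/eqP x0|/eqP y0].
      exists (0, 1, 0); rewrite ?inE //=.
      rewrite x0 -[RHS](@vline_scale _ _ y) ?xyz_scale ?mulr0 ?mulr1 //.
      by apply: contraNneq w0 => ->; rewrite x0 z0 eqxx.
    exists (1, 0, 0); rewrite ?inE //=.
    rewrite y0 -[RHS](@vline_scale _ _ x) ?xyz_scale ?mulr0 ?mulr1 //.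
    by apply: contraNneq w0 => ->; rewrite y0 z0 eqxx.
  have eab : c16 (x / z) (y / z) = 0.
    rewrite /c16; apply: (mulfI (expf_neq0 6 z0)); rewrite mulr0 -e; field.
    exact: z0.
  exists (x / z, y / z, 1).
    by have := c16_affine_points eab; rewrite !inE !xpair_eqE oner_eq0 eqxx !andbT !andbF /=;
      do ?[case/orP => [/andP[-> ->]|]; rewrite ?orbT //]; move=> /andP[-> ->]; rewrite ?orbT.
  by rewrite /= -[RHS](@vline_scale _ _ z) // xyz_scale mulr1 ![z * _]mulrC !divfK.
case=> [[[a b] c]] /= uS -> v /vlineP[k ->]; rewrite meval_homogenize_C16 /= xyz_scale !mxE /=.
by move: uS; rewrite !inE; do 6?[case/orP => [/eqP[-> -> ->]|]; first ring];
  move=> /eqP[-> -> ->]; ring.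
Qed.

(** * Configurations *)

Section Plane.
Variable K : fieldType.
Implicit Types (p q : point K) (l : line K) (v : 'rV[K]_3) (U W : {vspace 'rV[K]_3}).

Lemma dim_rV3 : \dim {:'rV[K]_3} = 3%N.
Proof. by rewrite dimvf. Qed.

(** The form is the projection onto the one-dimensional complement of the line, parallel to the
    line, followed by the coordinate on that complement. *)
Lemma line_form l : exists phi : {linear 'rV[K]_3 -> K^o},
  forall v, (v \in val l) = (phi v == 0).
Proof.
set U := val l; have dU : \dim U = 2%N := eqP (valP l).
have [w w0 ew] : exists2 w : 'rV[K]_3, w != 0 & (U^C)%VS = <[w]>%VS.
  apply: (@point_span K (exist _ (U^C)%VS _)).
  by rewrite dimv_compl dim_rV3 dU.
have [c cw] : exists c : {linear 'rV[K]_3 -> K^o}, forall k, c (k *: w) = k.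
  exists (coord [tuple w] ord0) => k.
  rewrite linearZ /= (coord_free ord0 ord0) ?eqxx; last by rewrite seq1_free.
  exact: mulr1.
have U0 : (U^C :&: U)%VS = 0%VS by rewrite capvC capv_compl.
have UT v : v \in (U^C + U)%VS by rewrite addvC addv_complf memvf.
exists (c \o daddv_pi U^C U) => v /=.
have [k ek] : exists k, daddv_pi U^C U v = k *: w.
  by apply/vlineP; rewrite -ew memv_pi.
have ev := daddv_pi_add U0 (UT v).
rewrite ek cw; apply/idP/eqP => [vU|k0]; last first.
  by rewrite -ev ek k0 scale0r add0r memv_pi.
have := ev; rewrite (daddv_pi_id (capv_compl U) vU) ek => /(canRL (addrK _)) /eqP.
by rewrite subrr scaler_eq0 (negPf w0) orbF => /eqP.
Qed.

(** For w nonzero in a complement of W, adding to W a complement of W + <w> gives dimension dim W +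
    3 - (dim W + 1) = 2, whatever dim W is. *)
Lemma sub_line W : W != fullv -> exists l, (W <= val l)%VS.
Proof.
move=> WT; pose w := vpick W^C.
have w0 : w != 0.
  rewrite vpick0; apply: contra WT => /eqP W0.
  by rewrite -(addv_complf W) W0 addv0.
have wW : (W :&: <[w]> = 0)%VS.
  apply/eqP; rewrite -subv0 -(capv_compl W) capvS //.
  by rewrite -memvE memv_pick.
have dWw : \dim (W + <[w]>) = (\dim W + 1)%N.
  by rewrite dimv_disjoint_sum // dim_vline w0.
have dU : \dim (W + (W + <[w]>)^C) == 2%N.
  rewrite dimv_disjoint_sum; last first.
    apply/eqP; rewrite -subv0 -(capv_compl (W + <[w]>)) capvS //; exact: addvSl.
  have := dimvS (subvf (W + <[w]>)); rewrite dimv_compl dim_rV3 dWw => dW.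
  by rewrite addnBA // subnDA addKn.
by exists (exist _ (W + (W + <[w]>)^C)%VS dU) => /=; apply: addvSl.
Qed.

Lemma point_of_two_lines p q l l' : l <> l' ->
  incident p l -> incident p l' -> incident q l -> incident q l' -> p = q.
Proof.
move=> ll' pl pl' ql ql'.
have dl : (\dim (val l :&: val l') <= 1)%N.
  rewrite leqNgt; apply/negP => d2; apply: ll'; apply: val_inj.
  have : (val l :&: val l')%VS == val l by rewrite eqEdim capvSl (eqP (valP l)).
  have : (val l :&: val l')%VS == val l' by rewrite eqEdim capvSr (eqP (valP l')).
  by move=> /eqP {2}<- /eqP.
suff e r : incident r l -> incident r l' -> val r = (val l :&: val l')%VS.
  by apply: val_inj; rewrite !e.
by move=> rl rl'; apply/eqP; rewrite eqEdim subv_cap rl rl' (eqP (valP r)).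
Qed.

(* Rescaling representatives of the first three points makes the fourth the unit point. *)
Lemma projective_frame (A B C D : point K) :
  ~ collinear A B C -> ~ collinear A B D -> ~ collinear A C D -> ~ collinear B C D ->
  exists e1 e2 e3, [/\ val A = <[e1]>%VS, val B = <[e2]>%VS, val C = <[e3]>%VS,
    val D = <[e1 + e2 + e3]>%VS & forall v, exists r s t, v = r *: e1 + s *: e2 + t *: e3].
Proof.
move=> nABC nABD nACD nBCD.
have [[a _ eA] [b _ eB]] := (point_span A, point_span B).
have [[c _ eC] [d _ eD]] := (point_span C, point_span D).
have full p q r : ~ collinear p q r -> (val p + val q + val r)%VS = fullv.
  move=> npqr; apply/eqP; apply: contraT => /sub_line[l].
  by rewrite !subv_add -andbA => /and3P[pl ql rl]; case: npqr; exists l.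
have span v : exists r s t, v = r *: a + s *: b + t *: c.
  have : v \in (val A + val B + val C)%VS by rewrite full // memvf.
  rewrite eA eB eC => /memv_addP[_ /memv_addP[_ /vlineP[r ->] [_ /vlineP[s ->] ->]]].
  by move=> [_ /vlineP[t ->] ->]; exists r, s, t.
(* If a coefficient of d on a, b, c vanished, D would lie on a line through two of the points A, B,
   C. *)
have nz p q (u w : 'rV[K]_3) : val p = <[u]>%VS -> val q = <[w]>%VS ->
    ~ collinear p q D -> forall s t, d <> s *: u + t *: w.
  move=> ep eq npqD s t ed; apply: npqD.
  have /sub_line[l] : (val p + val q)%VS != fullv.
    apply/eqP => pqT; have := dimv_add_leqif (val p) (val q).
    by rewrite pqT dim_rV3 (eqP (valP p)) (eqP (valP q)) => -[].
  rewrite subv_add => /andP[pl ql]; exists l; split=> //.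
  rewrite /incident eD -memvE ed memvD ?memvZ //; first by rewrite memvE -ep.
  by rewrite memvE -eq.
have [r [s [t ed]]] := span d.
have r0 : r != 0.
  by apply/eqP => r0; apply: (nz _ _ _ _ eB eC nBCD s t); rewrite ed r0 scale0r add0r.
have s0 : s != 0.
  by apply/eqP => s0; apply: (nz _ _ _ _ eA eC nACD r t); rewrite ed s0 scale0r addr0.
have t0 : t != 0.
  by apply/eqP => t0; apply: (nz _ _ _ _ eA eB nABD r s); rewrite ed t0 scale0r addr0.
exists (r *: a), (s *: b), (t *: c); split; rewrite ?vline_scale -?ed //.
move=> v; have [x [y [z ->]]] := span v.
by exists (x / r), (y / s), (z / t); rewrite !scalerA !divfK.
Qed.

End Plane.

(** * Line coordinates relative to a projective frame *)

Section Coordinates.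
Variables (K : fieldType) (e1 e2 e3 : 'rV[K]_3).
Hypothesis span : forall v, exists r s t, v = r *: e1 + s *: e2 + t *: e3.
Implicit Types (p : point K) (l : line K).

Definition line_eqn l (x y z : K) : Prop := forall r s t,
  (r *: e1 + s *: e2 + t *: e3 \in val l) = (x * r + y * s + z * t == 0).

Lemma line_eqn_exists l :
  exists x y z, line_eqn l x y z /\ ~~ [&& x == 0, y == 0 & z == 0].
Proof.
have [phi ephi] := line_form l; exists (phi e1), (phi e2), (phi e3); split.
  move=> r s t; rewrite ephi !linearD !linearZ.
  by rewrite (mulrC _ r) (mulrC _ s) (mulrC _ t).
apply/negP => /and3P[/eqP p1 /eqP p2 /eqP p3].
have := dim_rV3 K; suff <- : val l = fullv by rewrite (eqP (valP l)).
apply/eqP; rewrite eqEsubv subvf /=; apply/subvP => v _.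
have [r [s [t ->]]] := span v.
by rewrite ephi !linearD !linearZ /= p1 p2 p3 !scaler0 !addr0.
Qed.

(** Used to normalize equations: the scalar c is automatically nonzero because the original triple
    is. *)
Lemma line_eqn_scale l c x y z x' y' z' : line_eqn l x y z ->
  ~~ [&& x == 0, y == 0 & z == 0] -> x = c * x' -> y = c * y' -> z = c * z' ->
  line_eqn l x' y' z'.
Proof.
move=> lE nz ex ey ez; have c0 : c != 0.
  by apply: contraNneq nz => c0; rewrite ex ey ez c0 !mul0r eqxx.
move=> r s t; rewrite lE ex ey ez -[RHS](inj_eq (mulfI c0)) mulr0.
by congr (_ == 0); ring.
Qed.

Lemma line_eqn_inj l l' x y z : line_eqn l x y z -> line_eqn l' x y z -> l = l'.
Proof.
move=> lE lE'; apply: val_inj; apply/vspaceP => v.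
by have [r [s [t ->]]] := span v; rewrite lE lE'.
Qed.

Lemma line_eqn_incident l p x y z r s t : line_eqn l x y z ->
  val p = <[r *: e1 + s *: e2 + t *: e3]>%VS ->
  incident p l <-> x * r + y * s + z * t = 0.
Proof.
by move=> lE ep; rewrite /incident ep -memvE lE; split=> [/eqP|->].
Qed.

(** By Cramer's rule the determinant annihilates each coordinate of the common point, and these are
    not all zero. *)
Lemma concurrent_det p l1 l2 l3 x1 y1 z1 x2 y2 z2 x3 y3 z3 :
  incident p l1 -> incident p l2 -> incident p l3 ->
  line_eqn l1 x1 y1 z1 -> line_eqn l2 x2 y2 z2 -> line_eqn l3 x3 y3 z3 ->
  x1 * (y2 * z3 - z2 * y3) - y1 * (x2 * z3 - z2 * x3) + z1 * (x2 * y3 - y2 * x3) = 0.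
Proof.
have [v v0 ep] := point_span p; have [r [s [t ev]]] := span v.
rewrite ev in ep => i1 i2 i3 h1 h2 h3.
move/(line_eqn_incident h1 ep): i1 => {}h1; move/(line_eqn_incident h2 ep): i2 => {}h2.
move/(line_eqn_incident h3 ep): i3 => {}h3; set D := LHS.
have Dr : D * r = 0.
  transitivity ((x1 * r + y1 * s + z1 * t) * (y2 * z3 - z2 * y3)
    - (x2 * r + y2 * s + z2 * t) * (y1 * z3 - z1 * y3)
    + (x3 * r + y3 * s + z3 * t) * (y1 * z2 - z1 * y2)); first by rewrite /D; ring.
  by rewrite h1 h2 h3 !mul0r subr0 addr0.
have Ds : D * s = 0.
  transitivity (- (x1 * r + y1 * s + z1 * t) * (x2 * z3 - z2 * x3)
    + (x2 * r + y2 * s + z2 * t) * (x1 * z3 - z1 * x3)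
    - (x3 * r + y3 * s + z3 * t) * (x1 * z2 - z1 * x2)); first by rewrite /D; ring.
  by rewrite h1 h2 h3 oppr0 !mul0r subr0 addr0.
have Dt : D * t = 0.
  transitivity ((x1 * r + y1 * s + z1 * t) * (x2 * y3 - y2 * x3)
    - (x2 * r + y2 * s + z2 * t) * (x1 * y3 - y1 * x3)
    + (x3 * r + y3 * s + z3 * t) * (x1 * y2 - y1 * x2)); first by rewrite /D; ring.
  by rewrite h1 h2 h3 !mul0r subr0 addr0.
apply/eqP; apply: contraNT v0 => D0; rewrite ev.
have z w : D * w = 0 -> w = 0.
  by move=> /eqP; rewrite mulf_eq0 (negPf D0) => /eqP.
by rewrite (z _ Dr) (z _ Ds) (z _ Dt) !scale0r !addr0.
Qed.

End Coordinates.

(** * Böröczky configurations *)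

Lemma zero_sum_tripleP n (i j k : 'Z_n) :
  uniq [:: i; j; k] && (i + j + k == 0) -> [set i; j; k] \in zero_sum_triples n.
Proof.
rewrite /= !inE andbT negb_or => /andP[/andP[/andP[ij ik] jk] s0].
have kij : k \notin [set i; j] by rewrite !inE negb_or !(eq_sym k) ik.
rewrite setUC cardsU1 kij cards2 ij /=.
by rewrite big_setU1 //= big_setU1 ?inE //= big_set1 addrC.
Qed.

(** Otherwise the triple points of {i, j, k} and {i, j', k'} would both be the intersection of [L i]
    and [L j'], against the distinctness of triple points. *)
Lemma boroczky_off_line (K : fieldType) n (L : 'Z_n -> line K) P (i j k j' k' : 'Z_n) :
  nondegenerate_boroczky L P ->
  uniq [:: i; j; k] && (i + j + k == 0) -> uniq [:: i; j'; k'] && (i + j' + k' == 0) ->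
  j' \notin [:: j; k] -> ~ incident (P [set i; j; k]) (L j').
Proof.
move=> [injL inc injP] T T' nj' pj'.
have tT := zero_sum_tripleP T; have tT' := zero_sum_tripleP T'.
have ij' : i != j' by case/andP: T' => /=; rewrite !inE negb_or; case: eqP.
have eP : P [set i; j; k] = P [set i; j'; k'].
  apply: (@point_of_two_lines _ _ _ (L i) (L j')) => //.
  - by move=> /injL /eqP; rewrite (negPf ij').
  - by apply: inc; rewrite // !inE eqxx.
  - by apply: inc; rewrite // !inE eqxx.
  - by apply: inc; rewrite // !inE eqxx ?orbT.
have /setP /(_ j') := injP _ _ tT tT' eP.
rewrite !inE eqxx orbT (eq_sym j') (negPf ij') /=.
by move: nj'; rewrite !inE => /negPf ->.
Qed.

Lemma boroczky16_c16 (K : fieldType) (L : 'Z_16 -> line K) (P : {set 'Z_16} -> point K) :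
  nondegenerate_boroczky L P ->
  let A := P [set 0; 7; 9] in
  let B := P [set 1; 5; 10] in
  let C := P [set 6; 11; 15] in
  let D := P [set 0; 1; 15] in
  ~ collinear A B C -> ~ collinear A B D -> ~ collinear A C D -> ~ collinear B C D ->
  exists a b : K, c16 a b = 0 /\ [&& b != 0, a != 1, b != 1 & a != b].
Proof.
move=> cfg A B C D nABC nABD nACD nBCD.
have [e1 [e2 [e3 [eA eB eC eD span]]]] := projective_frame nABC nABD nACD nBCD.
pose eqn i := line_eqn e1 e2 e3 (L i).
have inc i j k : uniq [:: i; j; k] && (i + j + k == 0) ->
    [/\ incident (P [set i; j; k]) (L i), incident (P [set i; j; k]) (L j)
      & incident (P [set i; j; k]) (L k)].
  by move=> /zero_sum_tripleP T; split; apply: (boroczky_incidence cfg T);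
    rewrite !inE eqxx ?orbT.
have det i j k x1 y1 z1 x2 y2 z2 x3 y3 z3 : uniq [:: i; j; k] && (i + j + k == 0) ->
    eqn i x1 y1 z1 -> eqn j x2 y2 z2 -> eqn k x3 y3 z3 ->
    x1 * (y2 * z3 - z2 * y3) - y1 * (x2 * z3 - z2 * x3) + z1 * (x2 * y3 - y2 * x3) = 0.
  by move=> /inc[Pi Pj Pk]; apply: (concurrent_det span Pi Pj Pk).
have ex i : exists x y z, eqn i x y z /\ ~~ [&& x == 0, y == 0 & z == 0].
  exact: line_eqn_exists.
have neq i j x y z : i != j -> eqn i x y z -> eqn j x y z -> False.
  by move=> /eqP nij ei ej; apply/nij/(boroczky_lines_distinct cfg)/(line_eqn_inj span ei ej).
have onA i x y z : eqn i x y z -> incident A (L i) <-> x = 0.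
  move=> ei; rewrite (line_eqn_incident (r := 1) (s := 0) (t := 0) ei); last first.
    by rewrite scale1r !scale0r !addr0.
  by rewrite mulr1 !mulr0 !addr0.
have onB i x y z : eqn i x y z -> incident B (L i) <-> y = 0.
  move=> ei; rewrite (line_eqn_incident (r := 0) (s := 1) (t := 0) ei); last first.
    by rewrite scale1r !scale0r add0r addr0.
  by rewrite mulr1 !mulr0 add0r addr0.
have onC i x y z : eqn i x y z -> incident C (L i) <-> z = 0.
  move=> ei; rewrite (line_eqn_incident (r := 0) (s := 0) (t := 1) ei); last first.
    by rewrite scale1r !scale0r !add0r.
  by rewrite mulr1 !mulr0 !add0r.
have onD i x y z : eqn i x y z -> incident D (L i) <-> x + y + z = 0.
  move=> ei; rewrite (line_eqn_incident (r := 1) (s := 1) (t := 1) ei); last first.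
    by rewrite !scale1r.
  by rewrite !mulr1.
have [[A0 A7 A9] [B1 B5 B10]] := (inc 0 7 9 isT, inc 1 5 10 isT).
have [[C6 C11 C15] [D0 D1 D15]] := (inc 6 11 15 isT, inc 0 1 15 isT).
have E0 : eqn 0 0 1 (-1).
  have [x [y [z [E n]]]] := ex 0.
  have x0 := (onA _ _ _ _ E).1 A0; have := (onD _ _ _ _ E).1 D0.
  rewrite x0 add0r => /eqP; rewrite addrC addr_eq0 => /eqP z0.
  by apply: (line_eqn_scale E n (c := y)); rewrite ?mulr0 ?mulr1 ?mulrN1.
have E1 : eqn 1 1 0 (-1).
  have [x [y [z [E n]]]] := ex 1.
  have y0 := (onB _ _ _ _ E).1 B1; have := (onD _ _ _ _ E).1 D1.
  rewrite y0 addr0 => /eqP; rewrite addrC addr_eq0 => /eqP z0.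
  by apply: (line_eqn_scale E n (c := x)); rewrite ?mulr0 ?mulr1 ?mulrN1.
have E15 : eqn 15 1 (-1) 0.
  have [x [y [z [E n]]]] := ex 15.
  have z0 := (onC _ _ _ _ E).1 C15; have := (onD _ _ _ _ E).1 D15.
  rewrite z0 addr0 => /eqP; rewrite addrC addr_eq0 => /eqP y0.
  by apply: (line_eqn_scale E n (c := x)); rewrite ?mulr0 ?mulr1 ?mulrN1.
have [a E6] : exists a, eqn 6 1 (- a) 0.
  have [x [y [z [E n]]]] := ex 6; have z0 := (onC _ _ _ _ E).1 C6.
  have x0 : x != 0.
    by apply/eqP => /(onA _ _ _ _ E); apply: (boroczky_off_line (k' := 10) cfg).
  exists (- (y / x)); apply: (line_eqn_scale E n (c := x)); rewrite ?mulr0 ?mulr1 //.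
  by rewrite opprK mulrC divfK.
have [b E11] : exists b, eqn 11 1 (- b) 0.
  have [x [y [z [E n]]]] := ex 11; have z0 := (onC _ _ _ _ E).1 C11.
  have x0 : x != 0.
    by apply/eqP => /(onA _ _ _ _ E); apply: (boroczky_off_line (k' := 5) cfg).
  exists (- (y / x)); apply: (line_eqn_scale E n (c := x)); rewrite ?mulr0 ?mulr1 //.
  by rewrite opprK mulrC divfK.
have E10 : eqn 10 1 0 (- a).
  have [x [y [z [E n]]]] := ex 10; have y0 := (onB _ _ _ _ E).1 B10.
  have := det 0 6 10 _ _ _ _ _ _ _ _ _ isT E0 E6 E; rewrite y0 => d.
  have ez : z = x * - a by apply/eqP; rewrite -subr_eq0 -oppr_eq0 -d; apply/eqP; ring.
  by apply: (line_eqn_scale E n (c := x)); rewrite ?mulr0 ?mulr1.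
have E5 : eqn 5 1 0 (- b).
  have [x [y [z [E n]]]] := ex 5; have y0 := (onB _ _ _ _ E).1 B5.
  have := det 0 11 5 _ _ _ _ _ _ _ _ _ isT E0 E11 E; rewrite y0 => d.
  have ez : z = x * - b by apply/eqP; rewrite -subr_eq0 -oppr_eq0 -d; apply/eqP; ring.
  by apply: (line_eqn_scale E n (c := x)); rewrite ?mulr0 ?mulr1.
have E7 : eqn 7 0 1 (- a).
  have [x [y [z [E n]]]] := ex 7; have x0 := (onA _ _ _ _ E).1 A7.
  have := det 15 10 7 _ _ _ _ _ _ _ _ _ isT E15 E10 E; rewrite x0 => d.
  have ez : z = y * - a by apply/eqP; rewrite -subr_eq0 -d; apply/eqP; ring.
  by apply: (line_eqn_scale E n (c := y)); rewrite ?mulr0 ?mulr1.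
have E9 : eqn 9 0 (- a) 1.
  have [x [y [z [E n]]]] := ex 9; have x0 := (onA _ _ _ _ E).1 A9.
  have := det 1 6 9 _ _ _ _ _ _ _ _ _ isT E1 E6 E; rewrite x0 => d.
  have ey : y = z * - a by apply/eqP; rewrite -subr_eq0 -oppr_eq0 -d; apply/eqP; ring.
  by apply: (line_eqn_scale E n (c := z)); rewrite ?mulr0 ?mulr1.
(* Each forbidden value would give two different lines the same equation. *)
have a0 : a != 0.
  by apply/eqP => a0; move: E6 E10; rewrite a0 oppr0; apply: neq.
have b0 : b != 0.
  by apply/eqP => b0; move: E11 E5; rewrite b0 oppr0; apply: neq.
have a1 : a != 1.
  by apply/eqP => a1; move: E6 E15; rewrite a1; apply: neq.
have b1 : b != 1.
  by apply/eqP => b1; move: E11 E15; rewrite b1; apply: neq.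
have ab : a != b.
  by apply/eqP => ab; move: E6 E11; rewrite ab; apply: neq.
exists a, b; rewrite b0 a1 b1 ab; split=> //.
have a10 : a - 1 != 0 by rewrite subr_eq0.
have b10 : 1 - b != 0 by rewrite subr_eq0 eq_sym.
have E8 : eqn 8 (a + 1) (-1) (-1).
  have [x [y [z [E n]]]] := ex 8.
  have d := det 1 7 8 _ _ _ _ _ _ _ _ _ isT E1 E7 E.
  have d' := det 9 15 8 _ _ _ _ _ _ _ _ _ isT E9 E15 E.
  have {}d : x + a * y + z = 0 by rewrite -d; ring.
  have {}d' : x + y + a * z = 0 by rewrite -d'; ring.
  have ez : z = y.
    apply/esym/eqP; rewrite -subr_eq0 -(inj_eq (mulfI a10)) mulr0; apply/eqP.
    by transitivity (x + a * y + z - (x + y + a * z)); [ring | rewrite d d' subrr].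
  rewrite ez in d E n; apply: (line_eqn_scale E n (c := - y)); rewrite ?mulrN1 ?opprK //.
  by apply/eqP; rewrite -subr_eq0 -d; apply/eqP; ring.
have E4 : eqn 4 (a * b - 1) (b - b ^+ 2) (b - a * b).
  have [x [y [z [E n]]]] := ex 4.
  have d := det 1 11 4 _ _ _ _ _ _ _ _ _ isT E1 E11 E.
  have d' := det 5 7 4 _ _ _ _ _ _ _ _ _ isT E5 E7 E.
  have {}d : b * x + y + b * z = 0 by rewrite -oppr0 -d; ring.
  have {}d' : b * x + a * y + z = 0 by rewrite -d'; ring.
  have ez : (1 - b) * z = (1 - a) * y.
    apply/eqP; rewrite -subr_eq0; apply/eqP.
    by transitivity (b * x + a * y + z - (b * x + y + b * z)); [ring | rewrite d d' subrr].
  have bb0 : b * (1 - b) != 0 by rewrite mulf_neq0.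
  apply: (line_eqn_scale E n (c := y / (b * (1 - b)))).
  - apply: (mulfI bb0).
    transitivity ((1 - b) * (b * x + y + b * z) - (1 - b) * y - b * ((1 - b) * z)); first ring.
    by rewrite d ez; field; rewrite b0 b10.
  - by field; rewrite b0 b10.
  - by apply: (mulfI b10); rewrite ez; field; rewrite b0 b10.
have E2 : eqn 2 (1 - a ^+ 2) (a ^+ 3 * b + a ^+ 2 * b - a ^+ 2 - a * b) (a - a * b).
  have [x [y [z [E n]]]] := ex 2.
  have d := det 5 9 2 _ _ _ _ _ _ _ _ _ isT E5 E9 E.
  have d' := det 6 8 2 _ _ _ _ _ _ _ _ _ isT E6 E8 E.
  have {}d : a * b * x + y + a * z = 0 by rewrite -oppr0 -d; ring.
  have {}d' : a * x + y + (a ^+ 2 + a - 1) * z = 0 by rewrite -d'; ring.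
  have ex' : a * (1 - b) * x = (1 - a ^+ 2) * z.
    apply/eqP; rewrite -subr_eq0; apply/eqP.
    transitivity (a * x + y + (a ^+ 2 + a - 1) * z - (a * b * x + y + a * z)); first ring.
    by rewrite d d' subrr.
  have ab0 : a * (1 - b) != 0 by rewrite mulf_neq0.
  apply: (line_eqn_scale E n (c := z / (a * (1 - b)))).
  - by apply: (mulfI ab0); rewrite ex'; field; rewrite a0 b10.
  - apply: (mulfI ab0).
    transitivity (a * (1 - b) * (a * b * x + y + a * z) - a * b * (a * (1 - b) * x)
      - a * (1 - b) * a * z); first ring.
    by rewrite d ex'; field; rewrite a0 b10.
  - by field; rewrite a0 b10.
have d := det 2 4 10 _ _ _ _ _ _ _ _ _ isT E2 E4 E10.
apply: (mulfI a0); rewrite mulr0 -d /c16; ring.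
Qed.

Theorem mainTheorem6 :
  (forall p : point rat,
     on_projective_closure C16 p <->
     exists2 u : rat * rat * rat,
       u \in [:: (1, 1, 1); (0, 1, 0); (0, 0, 1); (1, 0, 0);
                 (-2, -2, 1); (-1, 1, 1); (-1, -1, 1)]
       & has_coords p u)
  /\
  ~ (exists (L : 'Z_16 -> line rat) (P : {set 'Z_16} -> point rat),
       nondegenerate_boroczky L P /\
       let A := P [set 0; 7; 9] in
       let B := P [set 1; 5; 10] in
       let C := P [set 6; 11; 15] in
       let D := P [set 0; 1; 15] in
       [/\ ~ collinear A B C, ~ collinear A B D,
           ~ collinear A C D & ~ collinear B C D]).
Proof.
split; first exact: C16_projective_points.
move=> [L [P [cfg /= [nABC nABD nACD nBCD]]]].
have [a [b [ab0 /and4P[b0 a1 b1 ab]]]] := boroczky16_c16 cfg nABC nABD nACD nBCD.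
(* The inequalities leave only (-2, -2) and (-1, -1), both with a = b. *)
have := c16_affine_points ab0; rewrite !inE !xpair_eqE (negPf b0) (negPf a1) (negPf b1).
by rewrite !andbF /= => /orP[] /andP[/eqP ea /eqP eb]; rewrite ea eb eqxx in ab.
Qed.
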